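(* Let $x=(x_i)_{i\in I}$ be a probability distribution on a totally ordered set $I$. For $n\geq 0$ and $j\ge0$ let $I_n(j)$ (respectively $M_n(j)$) denote the probability that $w\in\mathfrak{S}_n$, chosen from the QS$(x)$-distribution, satisfies $\mathrm{inv}(w)=j$ (respectively $\mathrm{maj}(w)=j$). Then, for all $n$ and $j$, $$M_n(j)=I_n(j),$$ and $$\sum_{n\ge0}\sum_{j\ge0}\frac{M_n(j)\,t^jz^n}{(1-t)(1-t^2)\cdots(1-t^n)}=\prod_{i\ge1}\prod_{j\in I}\left(1-t^{i-1}x_jz\right)^{-1}.$$
   Context: Let $x=(x_i)_{i\in I}$ with $x_i\ge0$, $\sum_i x_i=1$. QS$(x)$-distribution on $\mathfrak{S}_n$: choose $i_1,\dots,i_n\in I$ independently from $x$ and take the standardization $w$ of $i_1\cdots i_n$. That is, if $\alpha_1<\cdots<\alpha_k$ are the elements of $I$ that actually appear and $\alpha_r$ appears $a_r$ times, replace the $\alpha_1$'s by $1,\dots,a_1$ from left to right, then the $\alpha_2$'s by $a_1+1,\dots,a_1+a_2$ from left to right, etc. $\mathrm{inv}(w)=\#\{(i,j): 1\le i<j\le n,\ w(i)>w(j)\}$; $\mathrm{maj}(w)=\sum_{i\in D(w)}i$, where $D(w)=\{i: 1\le i\le n-1,\ w(i)>w(i+1)\}$. For $n=0$ the convention is $M_0(0)=I_0(0)=1$ and the empty product is $1$. The generating function identity is an identity of formal power series in $t$ and $z$ with real coefficients (when $I$ is infinite, the coefficients on the right are given by absolutely convergent series). *)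

(* Defs.v *)
From HB Require Import structures.
From mathcomp Require Import all_boot all_order all_algebra all_fingroup.
From mathcomp Require Import finmap.
From mathcomp Require Import all_classical all_reals all_analysis.
From mathcomp.analysis.showcase Require Import summability.

Set Implicit Arguments.
Unset Strict Implicit.
Unset Printing Implicit Defensive.

Import Order.TTheory GRing.Theory Num.Theory.
Import numFieldNormedType.Exports.

Local Open Scope ring_scope.

Section Standardization.
Context {d : Order.disp_t} {I : orderType d}.
Local Open Scope nat_scope.

(* If a occurs at position i of u, the letters smaller than a take up the first
   \sum_(b < a) (multiplicity of b) values, and the occurrences of a then get
   the next values from left to right.  Values are counted from 0. *)
Definition std_val n (u : n.-tuple I) (i : 'I_n) : nat :=
  \sum_(b <- undup u | (b < tnth u i)%O) count_mem b u
  + count_mem (tnth u i) (take i u).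

Lemma sum_count_undup (P : pred I) (s : seq I) :
  \sum_(b <- undup s | P b) count_mem b s = count P s.
Proof.
rewrite -sum1_count -[RHS]big_undup_iterop_count; apply: eq_bigr => b _.
case: (count_mem b s) => // k; elim: k => //= k {1}->.
by case: k.
Qed.

Lemma std_val_lt_count n (u : n.-tuple I) (i : 'I_n) :
  std_val u i < count (fun b => (b <= tnth u i)%O) u.
Proof.
rewrite /std_val sum_count_undup.
have -> : count (fun b => (b <= tnth u i)%O) u
    = count (fun b => (b < tnth u i)%O) u + count_mem (tnth u i) u.
  have count0 : count (predI (fun b => (b < tnth u i)%O) (pred1 (tnth u i))) u = 0.
    apply/eqP; rewrite -leqn0 leqNgt -has_count; apply/hasPn => b _ /=.
    by rewrite lt_neqAle andbAC andNb.
  rewrite -count_predUI count0 addn0; apply: eq_count => b /=.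
  by rewrite le_eqVlt orbC.
rewrite ltn_add2l -[in ltnRHS](cat_take_drop i u) count_cat -[ltnLHS]addn0.
rewrite ltn_add2l (drop_nth (tnth u i)) ?size_tuple //= -tnth_nth eqxx.
by rewrite add1n.
Qed.

Lemma std_val_lt n (u : n.-tuple I) (i : 'I_n) : std_val u i < n.
Proof.
by rewrite (leq_trans (std_val_lt_count u i)) // -[leqRHS](size_tuple u)
  count_size.
Qed.

Definition std_ord n (u : n.-tuple I) (i : 'I_n) : 'I_n :=
  Ordinal (std_val_lt u i).

Lemma std_ord_inj n (u : n.-tuple I) : injective (std_ord u).
Proof.
have lt_neq i j : (tnth u i < tnth u j)%O -> std_val u i < std_val u j.
  move=> ltij; apply: (leq_trans (std_val_lt_count u i)).
  rewrite {1}/std_val sum_count_undup (leq_trans _ (leq_addr _ _)) //.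
  by apply: sub_count => b /= leb; apply: le_lt_trans ltij.
have eq_neq (i j : 'I_n) : tnth u i = tnth u j -> i < j ->
    std_val u i < std_val u j.
  move=> eqij ltij; rewrite /std_val eqij ltn_add2l.
  have -> : take i u = take i (take j u) by rewrite take_takel // ltnW.
  rewrite -[in ltnRHS](cat_take_drop i (take j u)) count_cat -[ltnLHS]addn0.
  have szj : size (take j u) = j by rewrite size_takel // size_tuple ltnW.
  rewrite ltn_add2l (drop_nth (tnth u i)) ?szj //=.
  by rewrite nth_take // -tnth_nth eqij eqxx.
move=> i j /(congr1 val)/= eqv.
case: (ltgtP (tnth u i) (tnth u j)) => [/lt_neq|/lt_neq|eqij].
- by rewrite eqv ltnn.
- by rewrite eqv ltnn.
apply: val_inj; case: (ltngtP i j) => // [/(eq_neq _ _ eqij)|].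
  by rewrite eqv ltnn.
by move/(eq_neq _ _ (esym eqij)); rewrite eqv ltnn.
Qed.

Definition std n (u : n.-tuple I) : 'S_n := perm (@std_ord_inj n u).

End Standardization.

Definition inv_perm n (w : 'S_n) : nat :=
  #|[set p : 'I_n * 'I_n | (p.1 < p.2)%N && (w p.2 < w p.1)%N]|.

(* The descent i : 'I_n is the position i + 1 of the usual numbering from 1. *)
Definition descents n (w : 'S_n) : {set 'I_n} :=
  [set i : 'I_n | [exists j : 'I_n, (j == i.+1 :> nat) && (w j < w i)%N]].

Definition maj_perm n (w : 'S_n) : nat := (\sum_(i in descents w) i.+1)%N.

Section QS.
Context {R : realType} {d : Order.disp_t} {I : orderType d}.
Variable x : I -> R.

Definition is_distr : Prop :=
  (forall i, 0 <= x i) /\ \esum_(i in [set: I]) (x i)%:E = 1%E.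

Definition word_prob n (u : n.-tuple I) : R := \prod_(k < n) x (tnth u k).

Definition QS n (w : 'S_n) : \bar R :=
  \esum_(u in [set u : n.-tuple I | std u = w]) (word_prob u)%:E.

Definition QS_prob n (A : {set 'S_n}) : R := fine (\sum_(w in A) QS w)%E.

Definition inv_prob n (j : nat) : R :=
  QS_prob [set w : 'S_n | inv_perm w == j].

Definition maj_prob n (j : nat) : R :=
  QS_prob [set w : 'S_n | maj_perm w == j].

End QS.

Record fps (R : Type) := Fps { fps_coef : nat -> R }.

Section FpsRing.
Variable R : comNzRingType.
Implicit Types f g h : fps R.

HB.instance Definition _ := gen_eqMixin (fps R).
HB.instance Definition _ := gen_choiceMixin (fps R).

Lemma fpsP f g : fps_coef f =1 fps_coef g -> f = g.
Proof. by case: f g => [f] [g] /= /funext ->. Qed.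

Definition fps_add f g := Fps (fun n => fps_coef f n + fps_coef g n).
Definition fps_opp f := Fps (fun n => - fps_coef f n).
Definition fpsC (c : R) := Fps (fun n => if n is 0%N then c else 0).
Definition fps_mul f g :=
  Fps (fun n => \sum_(i < n.+1) fps_coef f i * fps_coef g (n - i)%N).

Lemma fps_addA : associative fps_add.
Proof. by move=> f g h; apply: fpsP => n /=; rewrite addrA. Qed.
Lemma fps_addC : commutative fps_add.
Proof. by move=> f g; apply: fpsP => n /=; rewrite addrC. Qed.
Lemma fps_add0 : left_id (fpsC 0) fps_add.
Proof. by move=> f; apply: fpsP => -[|n] /=; rewrite add0r. Qed.
Lemma fps_addN : left_inverse (fpsC 0) fps_opp fps_add.
Proof. by move=> f; apply: fpsP => -[|n] /=; rewrite addNr. Qed.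

HB.instance Definition _ :=
  GRing.isZmodule.Build (fps R) fps_addA fps_addC fps_add0 fps_addN.

Definition fps_trunc N f : {poly R} := \poly_(i < N) fps_coef f i.

Lemma fps_coef_mul f g N n : (n < N)%N ->
  fps_coef (fps_mul f g) n = (fps_trunc N f * fps_trunc N g)`_n.
Proof.
move=> ltnN; rewrite coefM /=; apply: eq_bigr => i _.
rewrite !coef_poly (leq_ltn_trans _ ltnN) ?(leq_ltn_trans (leq_subr _ _)) //.
by rewrite -ltnS.
Qed.

Lemma fps_mulC : commutative fps_mul.
Proof.
by move=> f g; apply: fpsP => n; rewrite !(@fps_coef_mul _ _ n.+1) // mulrC.
Qed.

Lemma fps_mulA : associative fps_mul.
Proof.
move=> f g h; apply: fpsP => n.
transitivity ((fps_trunc n.+1 f * (fps_trunc n.+1 g * fps_trunc n.+1 h))`_n).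
  rewrite (@fps_coef_mul _ _ n.+1) // !coefM; apply: eq_bigr => i _.
  by rewrite [X in _ * X]coef_poly ltnS leq_subr (@fps_coef_mul _ _ n.+1) //
    ltnS leq_subr.
rewrite mulrA (@fps_coef_mul _ _ n.+1) // !coefM; apply: eq_bigr => i _.
by rewrite [X in _ = X * _]coef_poly ltn_ord (@fps_coef_mul _ _ n.+1).
Qed.

Lemma fps_mul1 : left_id (fpsC 1) fps_mul.
Proof.
move=> f; apply: fpsP => n /=.
rewrite big_ord_recl /= mul1r subn0 big1 ?addr0 // => i _.
by rewrite mul0r.
Qed.

Lemma fps_mulDl : left_distributive fps_mul fps_add.
Proof.
move=> f g h; apply: fpsP => n /=.
by rewrite -big_split; apply: eq_bigr => i _; rewrite mulrDl.
Qed.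

Lemma fps_oner_neq0 : fpsC 1 != 0.
Proof. by apply/eqP => /(congr1 (@fps_coef R ^~ 0%N))/= /eqP; rewrite oner_eq0. Qed.

HB.instance Definition _ := GRing.Zmodule_isComNzRing.Build (fps R)
  fps_mulA fps_mulC fps_mul1 fps_mulDl fps_oner_neq0.

Definition fps_unit : {pred fps R} := fun f => `[< exists g, g * f = 1 >].

Definition fps_inv f : fps R :=
  if pselect (exists g, g * f = 1) is left h then sval (cid h) else f.

Lemma fps_mulVx : {in fps_unit, left_inverse 1 fps_inv *%R}.
Proof.
move=> f /asboolP uf; rewrite /fps_inv; case: pselect => // h.
exact: (svalP (cid h)).
Qed.

Lemma fps_unitPl f g : g * f = 1 -> fps_unit f.
Proof. by move=> gf1; apply/asboolP; exists g. Qed.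

Lemma fps_inv_out : {in [predC fps_unit], fps_inv =1 id}.
Proof.
by move=> f /asboolPn Nuf; rewrite /fps_inv; case: pselect.
Qed.

HB.instance Definition _ := GRing.ComNzRing_hasMulInverse.Build (fps R)
  fps_mulVx fps_unitPl fps_inv_out.

Definition fpsX : fps R := Fps (fun n => (n == 1%N)%:R).

End FpsRing.

(* In particular 1 - t^k (k >= 1) in R[[t]] and 1 - t^i * a * z in R[[t]][[z]] are
   units, so that their inverses below are not the default value of ^-1. *)
Lemma fps_unitE (R : comUnitRingType) (f : fps R) :
  (f \is a GRing.unit) = (fps_coef f 0 \is a GRing.unit).
Proof.
apply/idP/idP => [/asboolP[g /(congr1 (@fps_coef R ^~ 0%N))/=]|uf].
  by rewrite big_ord1 => gf1; apply/unitrPr; exists (fps_coef g 0);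
     rewrite mulrC.
pose c := (fps_coef f 0)^-1.
pose next (s : seq R) := - c * \sum_(i < size s) fps_coef f i.+1 * s`_(size s - i.+1).
pose s := fix s n := if n is m.+1 then rcons (s m) (if m is 0 then c else next (s m))
  else [::].
have size_s n : size (s n) = n by elim: n => //= n IH; rewrite size_rcons IH.
have nth_s n i : (i < n)%N -> (s n)`_i = (s i.+1)`_i.
  elim: n => // n IH; rewrite ltnS leq_eqVlt => /predU1P[->//|lt_in].
  by rewrite [s n.+1]/= nth_rcons size_s lt_in IH.
pose g := Fps (fun n => (s n.+1)`_n).
apply/asboolP; exists g; rewrite mulrC; apply: fpsP => -[|n] /=.
  by rewrite big_ord1 /= mulrV.
rewrite big_ord_recl /= subn0 nth_rcons size_rcons size_s ltnn eqxx.
set sn := rcons _ _; have -> : sn = s n.+1 by [].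
rewrite /next size_s mulrA mulrN mulrV // mulN1r addrC.
apply/eqP; rewrite subr_eq0; apply/eqP; apply: eq_bigr => i _.
rewrite subSS; congr (_ * _).
by rewrite [RHS]nth_s ?ltnS ?leq_subr.
Qed.

Section Bivariate.
Variable R : realType.
Local Open Scope classical_set_scope.

Definition fps2C (c : R) : fps (fps R) := fpsC (fpsC c).
(* Elements of R[[t]][[z]]: the outer series is in z, its coefficients in t. *)
Definition tvar : fps (fps R) := fpsC (@fpsX R).
Definition zvar : fps (fps R) := @fpsX (fps R).

Definition coef2 (f : fps (fps R)) (n j : nat) : R := fps_coef (fps_coef f n) j.

(* Convergence is coefficientwise in R, along the finite subsets of K directed
   by inclusion (the filter [totally]): for finite products this is the product
   itself, and it does not depend on any enumeration of K. *)
Definition partial_prod_coef (K : choiceType) (f : K -> fps (fps R))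
    (n j : nat) (F : {fset K}) : R :=
  coef2 (\prod_(k <- F) f k) n j.

Definition multipliable (K : choiceType) (f : K -> fps (fps R)) : Prop :=
  forall n j, cvg (partial_prod_coef f n j @ totally).

Definition infprod (K : choiceType) (f : K -> fps (fps R)) : fps (fps R) :=
  Fps (fun n => Fps (fun j => lim (partial_prod_coef f n j @ totally))).

End Bivariate.

Section GeneratingFunctions.
Context {R : realType} {d : Order.disp_t} {I : orderType d}.
Variable x : I -> R.

(* Grouped by powers of z: the coefficient of z^n is the power series
   \sum_j M_n(j) t^j divided by (1 - t) ... (1 - t^n) in R[[t]]. *)
Definition maj_gf : fps (fps R) :=
  Fps (fun n => Fps (fun j => maj_prob x n j)
                / \prod_(1 <= k < n.+1) (1 - fpsX R ^+ k)).

(* Here i : nat is the exponent of t, i.e. it is shifted by one from i >= 1. *)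
Definition qs_factor (i : nat) (j : I) : fps (fps R) :=
  (1 - tvar R ^+ i * fps2C (x j) * zvar R)^-1.

End GeneratingFunctions.

(* Main.v *)
(* On words over a finite ordered alphabet [s] both generating functions equal
   [(1 - t) ... (1 - t^n)] times the coefficient of [z^n] in the product [P(z)]
   over [a] in [s] of [\sum_n (x_a z)^n / ((1 - t) ... (1 - t^n))], which
   satisfies [P(t z) = \prod_a (1 - x_a z) P(z)].  This follows by induction on
   the length, removing the last letter, from the telescoping identity
   [\sum_a x_a z \prod_(c > a) (1 - x_c z) = 1 - \prod_c (1 - x_c z)]: the number
   of inversions changes by the number of letters larger than the last one, and
   for the major index one keeps track of the last letter, whose generating
   function is [x_a z \prod_(c > a) (1 - x_c z) P(z)].
   Taking limits over the finite subsets of [I] gives the first claim and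
   [P(z) = A(z) P(t z)], where [A(z)] is the product of the [1 / (1 - x_a z)];
   iterating, [P] is congruent to [A(z) A(t z) ... A(t^(N-1) z)] modulo [t^N]. *)

Require Import Defs.
From mathcomp Require Import all_boot all_order all_algebra all_fingroup.
From mathcomp Require Import finmap.
From mathcomp Require Import all_classical all_reals all_analysis.
From mathcomp.analysis.showcase Require Import summability.

Set Implicit Arguments.
Unset Strict Implicit.
Unset Printing Implicit Defensive.

Import Order.TTheory GRing.Theory Num.Theory.
Import numFieldNormedType.Exports.

Local Open Scope ring_scope.


(** * Coefficients of formal power series and the substitution of [c z] for [z] *)

Section FpsDilate.
Variable S : comNzRingType.
Implicit Types (f g : fps S) (c t : S).

Lemma coef_fps_mul f g n :
  fps_coef (f * g) n = \sum_(i < n.+1) fps_coef f i * fps_coef g (n - i)%N.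
Proof. by []. Qed.

Lemma coef_fpsB f g n : fps_coef (f - g) n = fps_coef f n - fps_coef g n.
Proof. by []. Qed.

Lemma coef_fps_sum (J : Type) (r : seq J) (P : pred J) (F : J -> fps S) n :
  fps_coef (\sum_(i <- r | P i) F i) n = \sum_(i <- r | P i) fps_coef (F i) n.
Proof. by elim/big_rec2: _ => [|i y1 y2 _ <-//]; case: n. Qed.

Lemma coef0_fps_prod (J : Type) (r : seq J) (P : pred J) (F : J -> fps S) :
  (forall i, fps_coef (F i) 0 = 1) ->
  fps_coef (\prod_(i <- r | P i) F i) 0 = 1.
Proof.
move=> F1; elim/big_rec: _ => // i f _ f1.
by rewrite coef_fps_mul big_ord1 F1 f1 mulr1.
Qed.

Lemma coef_fpsCM c f n : fps_coef (fpsC c * f) n = c * fps_coef f n.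
Proof.
rewrite coef_fps_mul big_ord_recl subn0 big1 ?addr0 // => i _.
by rewrite /= mul0r.
Qed.

Lemma coef_fpsXM f n :
  fps_coef (fpsX S * f) n = if n is m.+1 then fps_coef f m else 0.
Proof.
case: n => [|n]; first by rewrite coef_fps_mul big_ord1 mul0r.
rewrite coef_fps_mul !big_ord_recl mul0r add0r mul1r big1 ?addr0 => [|i _].
  by rewrite subSS subn0.
by rewrite mul0r.
Qed.

Lemma coef_fpsX_exp_mul k f n :
  fps_coef (fpsX S ^+ k * f) n = if (n < k)%N then 0 else fps_coef f (n - k)%N.
Proof.
elim: k n => [|k IH] n; first by rewrite mul1r subn0.
by rewrite exprS -mulrA coef_fpsXM; case: n => // n; rewrite IH subSS.
Qed.

Lemma coef_fps_cXM c f n :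
  fps_coef (fpsC c * fpsX S * f) n =
  if n is m.+1 then c * fps_coef f m else 0.
Proof.
by rewrite -mulrA coef_fpsCM coef_fpsXM; case: n => //; rewrite mulr0.
Qed.

Lemma coef_fps_cXMS c f n :
  fps_coef (fpsC c * fpsX S * f) n.+1 = c * fps_coef f n.
Proof. exact: coef_fps_cXM. Qed.

Lemma coef_fps_1BcXM c f n :
  fps_coef ((1 - fpsC c * fpsX S) * f) n =
  fps_coef f n - (if n is m.+1 then c * fps_coef f m else 0).
Proof. by rewrite mulrBl mul1r coef_fpsB coef_fps_cXM. Qed.

Lemma fpsC1 : fpsC 1 = 1 :> fps S. Proof. by []. Qed.

Lemma fpsCM c t : fpsC (c * t) = fpsC c * fpsC t.
Proof. by apply: fpsP => n; rewrite coef_fpsCM; case: n => //= n; rewrite mulr0. Qed.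

(** The substitution [f(c z)]. With [c = t] it is the shift in the functional equation of [P(z)]. *)
Definition dilate c f := Fps (fun n => c ^+ n * fps_coef f n).

Lemma coef_dilate c f n : fps_coef (dilate c f) n = c ^+ n * fps_coef f n.
Proof. by []. Qed.

Lemma dilateM c f g : dilate c (f * g) = dilate c f * dilate c g.
Proof.
apply: fpsP => n; rewrite /= mulr_sumr; apply: eq_bigr => i _.
by rewrite mulrACA -exprD subnKC // -ltnS.
Qed.

Lemma dilate1 c : dilate c 1 = 1.
Proof. by apply: fpsP => -[|n]; rewrite /= ?mul1r ?mulr0. Qed.

Lemma dilate_prod c (J : Type) (r : seq J) (P : pred J) (F : J -> fps S) :
  dilate c (\prod_(i <- r | P i) F i) = \prod_(i <- r | P i) dilate c (F i).
Proof. exact: (big_morph _ (dilateM c) (dilate1 c)). Qed.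

Lemma dilate_dilate c t f : dilate c (dilate t f) = dilate (c * t) f.
Proof. by apply: fpsP => n; rewrite /= mulrA exprMn. Qed.

Lemma dilate_id f : dilate 1 f = f.
Proof. by apply: fpsP => n; rewrite /= expr1n mul1r. Qed.

End FpsDilate.

(** * Telescoping sums over a finite totally ordered alphabet *)

Section Telescope.
Context {d : Order.disp_t} {I : orderType d} {S : comNzRingType}.
Implicit Types (s : seq I) (y : I -> S).

(** Both sides are invariant under permutation, so [s] may be sorted. If [a] is the smallest letter
    and [Q] is the product of [1 - y c] over the others, induction gives
    [y a * Q + (1 - Q) = 1 - (1 - y a) * Q]. *)
Lemma sum_mul_prod_gt s y : uniq s ->
  (\sum_(a <- s) y a * \prod_(c <- s | (a < c)%O) (1 - y c)
     = 1 - \prod_(c <- s) (1 - y c)).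
Proof.
suff sum_sorted r : sorted <%O r ->
    \sum_(a <- r) y a * \prod_(c <- r | (a < c)%O) (1 - y c)
      = 1 - \prod_(c <- r) (1 - y c).
  move=> us; have prs : perm_eq (sort <=%O s) s by exact/permEl/perm_sort.
  rewrite -(perm_big _ prs) -[in RHS](perm_big _ prs) -sum_sorted.
    by apply: eq_bigr => a _; congr *%R; rewrite -(perm_big _ prs).
  by rewrite lt_sorted_uniq_le sort_uniq us sort_le_sorted.
elim: r => [|a r IH] ss; first by rewrite !big_nil subrr.
have /= ra := order_path_min lt_trans ss.
rewrite !big_cons ltxx.
have -> : \prod_(c <- r | (a < c)%O) (1 - y c) = (\prod_(c <- r) (1 - y c)).
  rewrite big_seq_cond [RHS]big_seq; apply: eq_bigl => c.
  by case: (boolP (c \in r)) => // /(allP ra) ->.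
have -> : \sum_(b <- r) y b * \prod_(c <- a :: r | (b < c)%O) (1 - y c)
    = \sum_(b <- r) y b * \prod_(c <- r | (b < c)%O) (1 - y c).
  by apply: eq_big_seq => b /(allP ra) ab; rewrite big_cons ltNge ltW.
rewrite IH ?(path_sorted ss) // mulrBl mul1r.
by rewrite opprB addrCA.
Qed.

(** This is [sum_mul_prod_gt] on the subalphabet of letters larger than [a], which contains every
    [c > b] as soon as [b > a]. *)
Lemma sum_gt_mul_prod_gt s y a : uniq s ->
  (\sum_(b <- s | (a < b)%O) y b * \prod_(c <- s | (b < c)%O) (1 - y c)
     = 1 - \prod_(c <- s | (a < c)%O) (1 - y c)).
Proof.
move=> us; rewrite -[in RHS]big_filter -sum_mul_prod_gt ?filter_uniq //.
rewrite [RHS]big_filter; apply: eq_bigr => b ab; congr *%R.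
rewrite big_filter_cond; apply: eq_bigl => c.
by case: (boolP (b < c)%O) => [bc|_]; rewrite ?andbF // (lt_trans ab bc).
Qed.

End Telescope.

(** * Inversions and major index read off words *)

Section Words.
Context {d : Order.disp_t} {I : orderType d}.

Lemma std_val_mono n (u : n.-tuple I) (i j : 'I_n) :
  (tnth u i < tnth u j)%O -> (std_val u i < std_val u j)%N.
Proof.
move=> ltij; apply: (leq_trans (std_val_lt_count u i)).
rewrite /std_val sum_count_undup (leq_trans _ (leq_addr _ _)) //.
by apply: sub_count => b /= leb; apply: le_lt_trans ltij.
Qed.

Lemma std_val_le n (u : n.-tuple I) (i j : 'I_n) :
  tnth u i = tnth u j -> (i <= j)%N -> (std_val u i <= std_val u j)%N.
Proof.
move=> eqij leij; rewrite /std_val eqij leq_add2l.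
by rewrite -(subnKC leij) takeD count_cat leq_addr.
Qed.

(** Equal letters are numbered from left to right, so they never create an inversion. *)
Lemma std_desc n (u : n.-tuple I) (i j : 'I_n) : (i <= j)%N ->
  (std u j < std u i)%N = (tnth u j < tnth u i)%O.
Proof.
move=> leij; rewrite !permE /=.
case: (ltgtP (tnth u j) (tnth u i)) => [/std_val_mono //|/std_val_mono lt|eqji].
  by rewrite ltnNge ltnW.
by rewrite ltnNge std_val_le.
Qed.

(* A common form of both statistics: [inv] is obtained for [w i j = 1] and
   [maj] for [w i j = i + 1] if [j = i + 1] and [0] otherwise. *)
Definition desc_sum (w : nat -> nat -> nat) n (u : n.-tuple I) : nat :=
  (\sum_(j < n) \sum_(i < n | (i < j)%N && (tnth u j < tnth u i)%O) w i j)%N.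

Definition inv_wt (i j : nat) : nat := 1.
Definition maj_wt (i j : nat) : nat := if j == i.+1 then i.+1 else 0.

Lemma inv_perm_std n (u : n.-tuple I) : inv_perm (std u) = desc_sum inv_wt u.
Proof.
rewrite /inv_perm /desc_sum -sum1dep_card (exchange_big_dep predT) //=.
rewrite pair_big_dep; apply: eq_bigl => p /=.
by case: ltnP => //= /ltnW/std_desc ->.
Qed.

Lemma maj_perm_std n (u : n.-tuple I) : maj_perm (std u) = desc_sum maj_wt u.
Proof.
rewrite /maj_perm /desc_sum big_mkcond /= (exchange_big_dep predT) //=.
apply: eq_bigr => i _; rewrite inE.
rewrite (eq_bigr (fun j : 'I_n => if j == i.+1 :> nat then i.+1 else 0%N)) //.
rewrite -big_mkcondr; case: existsP => [[j /andP[/eqP ji stji]]|no_desc].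
  rewrite (big_pred1 j) // => k /=.
  apply/idP/eqP => [/andP[_ /eqP ki]|->]; first by apply: val_inj; rewrite /= ki.
  by rewrite -std_desc ji ?leqnSn // ltnSn stji eqxx.
rewrite big_pred0 // => j; apply/negP => /andP[/andP[ij uji] ji].
by case: no_desc; exists j; rewrite ji std_desc // ltnW.
Qed.

Lemma tnth_rcons_widen n (u : n.-tuple I) a (i : 'I_n) (h : (i < n.+1)%N) :
  tnth (rcons_tuple u a) (Ordinal h) = tnth u i.
Proof. by rewrite !(tnth_nth a) /= nth_rcons size_tuple ltn_ord. Qed.

Lemma tnth_rcons_max n (u : n.-tuple I) a :
  tnth (rcons_tuple u a) ord_max = a.
Proof. by rewrite (tnth_nth a) /= nth_rcons size_tuple ltnn eqxx. Qed.

Lemma desc_sum_rcons w n (u : n.-tuple I) a :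
  desc_sum w (rcons_tuple u a) =
  (desc_sum w u + \sum_(i < n | (a < tnth u i)%O) w i n)%N.
Proof.
rewrite /desc_sum big_ord_recr /=; congr addn.
  apply: eq_bigr => j _; rewrite [LHS]big_mkcond big_ord_recr /=.
  rewrite (ltnNge n) (ltnW (ltn_ord j)) /= addn0 [RHS]big_mkcond /=.
  by apply: eq_bigr => i _; rewrite !tnth_rcons_widen.
rewrite big_mkcond big_ord_recr /= ltnn addn0 [RHS]big_mkcond /=.
by apply: eq_bigr => i _; rewrite tnth_rcons_widen tnth_rcons_max ltn_ord.
Qed.

Lemma desc_sum_inv_rcons n (u : n.-tuple I) a :
  desc_sum inv_wt (rcons_tuple u a) =
  (desc_sum inv_wt u + count (fun b => (a < b)%O) u)%N.
Proof.
rewrite desc_sum_rcons; congr addn.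
by rewrite -sum1_count -(big_tuple _ _ u (fun b => (a < b)%O) (fun=> 1%N)).
Qed.

(** Only the pair formed by the last two letters is new with nonzero weight; [b] has index [n], that
    is, position [n + 1] counted from 1. *)
Lemma desc_sum_maj_rcons n (u : n.-tuple I) b a :
  desc_sum maj_wt (rcons_tuple (rcons_tuple u b) a) =
  (desc_sum maj_wt (rcons_tuple u b) + if (a < b)%O then n.+1 else 0)%N.
Proof.
rewrite desc_sum_rcons; congr addn.
rewrite big_mkcond big_ord_recr /= big1 ?add0n => [|i _].
  by rewrite tnth_rcons_max /maj_wt eqxx.
suff -> : maj_wt i n.+1 = 0%N by rewrite if_same.
by rewrite /maj_wt eqSS gtn_eqF.
Qed.

Lemma desc_sum1 w (u : 1.-tuple I) : desc_sum w u = 0%N.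
Proof. by rewrite /desc_sum big_ord1 big_mkcond big_ord1. Qed.

(** Letters are appended on the right, to match the inductions that remove the last letter. *)
Fixpoint words (s : seq I) n : seq (n.-tuple I) :=
  if n is m.+1 then [seq rcons_tuple u a | u <- words s m, a <- s]
  else [:: [tuple]].

Lemma big_words (V : nmodType) s n (F : n.+1.-tuple I -> V) :
  \sum_(u <- words s n.+1) F u =
  \sum_(u <- words s n) \sum_(a <- s) F (rcons_tuple u a).
Proof. exact: big_allpairs_dep. Qed.

Lemma tuple_rconsP n (u : n.+1.-tuple I) :
  exists v a, u = rcons_tuple v a.
Proof.
case: u => s; case: (lastP s) => [//|s' a] sz.
have sz' : size s' == n by rewrite size_rcons in sz.
by exists (Tuple sz'), a; apply: val_inj.
Qed.

Lemma rcons_tuple_inj n (u v : n.-tuple I) a b :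
  rcons_tuple u a = rcons_tuple v b ->
  (u, a) = (v, b).
Proof. by move=> /(congr1 val)/= /rcons_inj[/val_inj -> ->]. Qed.

Lemma mem_words s n (u : n.-tuple I) : (u \in words s n) = all [in s] u.
Proof.
elim: n u => [|n IH] u; first by rewrite tuple0 inE eqxx.
have [v [a ->]] := tuple_rconsP u; rewrite all_rcons -IH andbC.
apply/allpairsP/andP => [[[v' a'] /= [v's a's /rcons_tuple_inj[-> ->]]]|[vs as_]] //.
by exists (v, a).
Qed.

Lemma words_uniq s n : uniq s -> uniq (words s n).
Proof.
move=> us; elim: n => // n IH; apply: allpairs_uniq => // -[u a] [v b] _ _.
exact: rcons_tuple_inj.
Qed.

End Words.

(** * Generating functions of both statistics over a finite alphabet *)

Section FiniteAlphabet.
Context {d : Order.disp_t} {I : orderType d} {S : comUnitRingType}.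
Variable t : S.
Hypothesis unit_1Bt : forall n, 1 - t ^+ n.+1 \is a GRing.unit.
Implicit Types (x : I -> S) (c : S) (f : fps S).

(** The Pochhammer symbol [(t; t)_n]. *)
Definition qfact n : S := \prod_(1 <= k < n.+1) (1 - t ^+ k).

Lemma qfact0 : qfact 0 = 1. Proof. by rewrite /qfact big_geq. Qed.

Lemma qfactS n : qfact n.+1 = qfact n * (1 - t ^+ n.+1).
Proof. by rewrite /qfact big_nat_recr. Qed.

Lemma qfact_unit n : qfact n \is a GRing.unit.
Proof. by elim: n => [|n IH]; rewrite ?qfact0 ?unitr1 // qfactS unitrM IH /=. Qed.

(* [qexp c] is the expansion of the product of the 1 / (1 - t^i c z), i >= 0, as
   its functional equation [dilate_qexp] shows. *)
Definition qexp c : fps S := Fps (fun n => c ^+ n / qfact n).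

Lemma dilate_qexp c : dilate t (qexp c) = (1 - fpsC c * fpsX S) * qexp c.
Proof.
apply: fpsP => n; rewrite coef_fps_1BcXM.
case: n => [|n]; first by rewrite coef_dilate expr0 mul1r subr0.
have -> : c * fps_coef (qexp c) n = fps_coef (qexp c) n.+1 * (1 - t ^+ n.+1).
  rewrite /= mulrA -exprS qfactS invrM ?qfact_unit //.
  by rewrite [_^-1 * _]mulrC [in RHS]mulrA divrK.
by rewrite mulrBr mulr1 opprB addrC subrK mulrC.
Qed.

Lemma qexpM c : qexp (t * c) = dilate t (qexp c).
Proof. by apply: fpsP => n; rewrite /= exprMn mulrA. Qed.

(** The series [P(z)] for the alphabet [s]. *)
Definition qprod (s : seq I) x : fps S := \prod_(a <- s) qexp (x a).

Lemma coef0_qprod s x : fps_coef (qprod s x) 0 = 1.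
Proof.
by apply: coef0_fps_prod => a; rewrite /= qfact0 divr1.
Qed.

Notation lin x a := (1 - fpsC (x a) * fpsX S).

Lemma dilate_qprod s x :
  dilate t (qprod s x) = \prod_(a <- s) lin x a * qprod s x.
Proof.
by rewrite dilate_prod -big_split; apply: eq_bigr => a _; apply: dilate_qexp.
Qed.

(** After multiplication by [z], telescoping turns the sum into [P(z)] minus the product of all
    [1 - x_c z] times [P(z)], which is [P(z) - P(t z)]. *)
Lemma coef_sum_lin_qprod s x n : uniq s ->
  \sum_(a <- s) x a * fps_coef
    (\prod_(c <- s | (a < c)%O) lin x c * qprod s x) n
  = (1 - t ^+ n.+1) * fps_coef (qprod s x) n.+1.
Proof.
move=> us.
rewrite (eq_bigr _ (fun a _ => esym (coef_fps_cXMS (x a) _ n))).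
under eq_bigr do rewrite mulrA.
rewrite -coef_fps_sum -mulr_suml sum_mul_prod_gt // mulrBl mul1r -dilate_qprod.
by rewrite coef_fpsB coef_dilate mulrBl mul1r.
Qed.

Lemma coef_sum_gt_lin_qprod s x a n : uniq s ->
  \sum_(b <- s | (a < b)%O) x b * fps_coef
    (\prod_(c <- s | (b < c)%O) lin x c * qprod s x) n
  = fps_coef (qprod s x) n.+1
    - fps_coef (\prod_(c <- s | (a < c)%O) lin x c * qprod s x) n.+1.
Proof.
move=> us.
rewrite (eq_bigr _ (fun b _ => esym (coef_fps_cXMS (x b) _ n))).
under eq_bigr do rewrite mulrA.
rewrite -coef_fps_sum -mulr_suml sum_gt_mul_prod_gt // mulrBl mul1r.
by rewrite coef_fpsB.
Qed.

Definition word_gf (w : nat -> nat -> nat) s x n : S :=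
  \sum_(u <- words s n) t ^+ desc_sum w u * \prod_(a <- u) x a.

Lemma word_gf0 w s x : word_gf w s x 0 = 1.
Proof. by rewrite /word_gf /= big_seq1 big_nil mulr1 /desc_sum big_ord0. Qed.

(* Removing the last letter [a] multiplies the weight of each remaining letter
   larger than [a] by [t]. *)
Lemma inv_gfE s x n : uniq s ->
  word_gf inv_wt s x n = qfact n * fps_coef (qprod s x) n.
Proof.
move=> us; elim: n x => [|n IH] x.
  by rewrite word_gf0 qfact0 coef0_qprod mul1r.
pose y a b := if (a < b)%O then t * x b else x b.
transitivity (\sum_(a <- s) x a * word_gf inv_wt s (y a) n).
  rewrite /word_gf big_words exchange_big; apply: eq_bigr => a _.
  rewrite mulr_sumr; apply: eq_bigr => u _.
  rewrite desc_sum_inv_rcons big_rcons exprD.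
  rewrite /= mulrA [LHS]mulrC -mulrA; congr (_ * (_ * _)).
  elim: (tval u) => [|b v IHv]; first by rewrite !big_nil mulr1.
  rewrite !big_cons /= exprD -IHv mulrACA; congr (_ * _).
  by rewrite /y; case: ifP; rewrite ?expr1 ?mul1r.
(* Replacing [x b] by [t * x b] dilates the factor of [b], which by [dilate_qexp] multiplies it by
   [1 - x_b z]. The induction hypothesis, general in the weights, thus yields the telescoping
   summands. *)
have qprod_y a : qprod s (y a) = \prod_(b <- s | (a < b)%O) lin x b * qprod s x.
  rewrite big_mkcond -big_split; apply: eq_bigr => b _ /=.
  by rewrite /y; case: ifP; rewrite ?mul1r // qexpM dilate_qexp.
under eq_bigr do rewrite IH qprod_y mulrCA.
by rewrite -mulr_sumr coef_sum_lin_qprod // mulrA -qfactS.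
Qed.

(** The final letter [a] is fixed and carries no factor [x a]. The induction sums over the letter
    [b] before it, which contributes [t ^+ n.+1] exactly when [a < b]. *)
Lemma maj_gf_last s x a n : uniq s ->
  \sum_(u <- words s n) t ^+ desc_sum maj_wt (rcons_tuple u a) * \prod_(b <- u) x b
  = qfact n * fps_coef (\prod_(c <- s | (a < c)%O) lin x c * qprod s x) n.
Proof.
move=> us; elim: n a => [|n IH] a.
  rewrite big_seq1 big_nil mulr1 desc_sum1 qfact0 mul1r expr0.
  rewrite coef_fps_mul big_ord1 coef0_qprod mulr1.
  by rewrite coef0_fps_prod // => c; rewrite -[lin x c]mulr1 coef_fps_1BcXM subr0.
pose G := fun b => \sum_(u <- words s n)
  t ^+ desc_sum maj_wt (rcons_tuple u b) * \prod_(c <- u) x c.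
have xG b : x b * G b = qfact n * (x b * fps_coef
    (\prod_(c <- s | (b < c)%O) lin x c * qprod s x) n).
  by rewrite mulrCA -IH.
(* Writing [t ^+ n.+1] as [1 - (1 - t ^+ n.+1)] separates a sum over all [b] from a sum over
   [b > a]; both telescope. *)
transitivity (\sum_(b <- s) x b * G b
    - (1 - t ^+ n.+1) * \sum_(b <- s | (a < b)%O) x b * G b).
  rewrite big_words exchange_big mulr_sumr [in X in _ - X]big_mkcond -sumrB.
  apply: eq_bigr => b _; transitivity
    ((if (a < b)%O then t ^+ n.+1 else 1) * (x b * G b)).
    rewrite !mulr_sumr; apply: eq_bigr => u _.
    rewrite desc_sum_maj_rcons big_rcons exprD /=; case: ifP => _.
      by rewrite [t ^+ _ * _]mulrC -mulrA; congr *%R; rewrite mulrA mulrC.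
    by rewrite expr0 mulr1 mul1r mulrA mulrC.
  by case: ifP => _; rewrite ?subr0 ?mul1r // mulrBl mul1r opprB addrC subrK.
rewrite !(eq_bigr _ (fun b _ => xG b)).
(* The coefficients of [P] cancel, leaving [1 - t ^+ n.+1] times the coefficient of the product over
   [c > a]. *)
rewrite -!mulr_sumr coef_sum_lin_qprod // coef_sum_gt_lin_qprod //.
by rewrite mulrCA -!mulrBr subKr mulrA qfactS [qfact n * _]mulrC.
Qed.

(** For nonempty words, [maj_gf_last] is summed over the last letter with weights [x a], and the sum
    telescopes. *)
Lemma maj_gfE s x n : uniq s ->
  word_gf maj_wt s x n = qfact n * fps_coef (qprod s x) n.
Proof.
case: n => [|n] us; first by rewrite word_gf0 qfact0 coef0_qprod mul1r.
rewrite /word_gf big_words exchange_big /= qfactS -mulrA.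
rewrite -coef_sum_lin_qprod // mulr_sumr; apply: eq_bigr => a _.
rewrite mulrCA -maj_gf_last // mulr_sumr; apply: eq_bigr => u _.
by rewrite big_rcons /= mulrA mulrC.
Qed.

End FiniteAlphabet.

(* Limits along the finite subsets directed by inclusion *)
#[local] Existing Instance totally_filter.

Section SubsetSums.

Lemma perm_sub_cat (T : eqType) (r r' : seq T) :
  uniq r -> uniq r' -> {subset r <= r'} ->
  perm_eq r' (r ++ [seq a <- r' | a \notin r]).
Proof.
move=> ur ur' sub; apply: uniq_perm => //.
  rewrite cat_uniq ur filter_uniq // andbT; apply/hasPn => a.
  by rewrite mem_filter => /andP[].
move=> a; rewrite mem_cat mem_filter; case: (boolP (a \in r)) => //= ar.
exact: sub.
Qed.

Lemma ler_sum_sub (R : numDomainType) (T : eqType) (r r' : seq T) (v : T -> R) :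
  uniq r -> uniq r' -> {subset r <= r'} -> (forall a, 0 <= v a) ->
  \sum_(a <- r) v a <= \sum_(a <- r') v a.
Proof.
move=> ur ur' sub v0; rewrite (perm_big _ (perm_sub_cat ur ur' sub)) big_cat.
by rewrite lerDl sumr_ge0.
Qed.

End SubsetSums.

Section TotallyLimits.
Local Open Scope classical_set_scope.
Context {R : realType} {K : choiceType}.
Implicit Types (f : {fset K} -> R).

Lemma cvg_totally_le f l : (forall F, f F <= l) ->
  (forall e, 0 < e -> exists F0, forall F, (F0 `<=` F)%fset -> l - e < f F) ->
  f @ totally --> l.
Proof.
move=> fl lf; apply/cvgrPdist_lt => e /lf[F0 F0P]; exists F0 => //= F F0F.
by rewrite ger0_norm ?subr_ge0 ?fl // ltrBlDr -ltrBlDl; apply: F0P.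
Qed.

(** Monotone convergence: the limit is the supremum of the values. *)
Lemma nondecreasing_cvg_totally f B :
  (forall F F', (F `<=` F')%fset -> f F <= f F') -> (forall F, f F <= B) ->
  cvg (f @ totally).
Proof.
move=> fmono fB; have fsup : has_sup (range f).
  by split; [exists (f fset0), fset0 | exists B => _ [F _ <-]].
apply: (cvgP (sup (range f))); apply: cvg_totally_le => [F|e e0].
  by apply: (ub_le_sup fsup.2); exists F.
have [_ [F0 _ <-] lt] := sup_adherent e0 fsup.
by exists F0 => F /fmono; apply: lt_le_trans.
Qed.

Lemma cvg_totally_sum (J : Type) (r : seq J) (P : pred J)
    (f : J -> {fset K} -> R) (l : J -> R) :
  (forall j, P j -> f j @ totally --> l j) ->
  (fun F => \sum_(j <- r | P j) f j F) @ totally --> \sum_(j <- r | P j) l j.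
Proof.
by move=> fl; apply: cvg_big => //; exact: add_continuous.
Qed.

End TotallyLimits.

(** * QS-probabilities as limits over finite alphabets *)

Section WordLimits.
Local Open Scope classical_set_scope.
Context {R : realType} {d : Order.disp_t} {I : orderType d}.
Variable x : I -> R.
Hypothesis x_ge0 : forall i, 0 <= x i.
Hypothesis x_le1 : forall F : {fset I}, \sum_(a <- F) x a <= 1.

Lemma word_prob_ge0 n (u : n.-tuple I) : 0 <= word_prob x u.
Proof. by apply: prodr_ge0. Qed.

Lemma word_probE n (u : n.-tuple I) : word_prob x u = \prod_(a <- u) x a.
Proof. by rewrite big_tuple. Qed.

Lemma sum_word_prob (s : seq I) n :
  \sum_(u <- words s n) word_prob x u = (\sum_(a <- s) x a) ^+ n.
Proof.
elim: n => [|n IH]; first by rewrite big_seq1 /word_prob big_ord0.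
rewrite big_words exprSr -IH mulr_suml; apply: eq_bigr => u _.
by rewrite mulr_sumr; apply: eq_bigr => a _; rewrite !word_probE big_rcons.
Qed.

Lemma sum_word_prob_le1 n (P : pred (n.-tuple I)) (F : {fset I}) :
  \sum_(u <- words F n | P u) word_prob x u <= 1.
Proof.
apply: (@le_trans _ _ (\sum_(u <- words F n) word_prob x u)).
  by rewrite big_mkcond ler_sum // => u _; case: ifP; rewrite ?word_prob_ge0.
by rewrite sum_word_prob exprn_ile1 // sumr_ge0.
Qed.

(** A finite set of words uses finitely many letters, which form [F0]. All its words are then words
    over any [F] containing [F0], and the weights are nonnegative. *)
Lemma fsets_words n (P : pred (n.-tuple I)) (X : set (n.-tuple I)) :
  fsets [set u | P u] X -> exists F0 : {fset I}, forall F, (F0 `<=` F)%fset ->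
    (\sum_(u \in X) (word_prob x u)%:E
       <= (\sum_(u <- words F n | P u) word_prob x u)%:E)%E.
Proof.
move=> [/finite_seqP[r ->] XP].
exists [fset a in flatten [seq tval u | u <- r]]%fset => F F0F.
have -> : [set` r] = [set` undup r].
  by apply/seteqP; split => u /=; rewrite mem_undup.
rewrite -fsbig_seq ?undup_uniq // sumEFin lee_fin -[leRHS]big_filter.
apply: ler_sum_sub => [|| u |u]; rewrite ?undup_uniq ?word_prob_ge0 //.
  by rewrite filter_uniq ?words_uniq ?fset_uniq.
rewrite mem_undup => ur; rewrite mem_filter mem_words; apply/andP; split.
  exact: XP.
apply/allP => a au; apply: (fsubsetP F0F); rewrite inE; apply/flattenP.
by exists (tval u) => //; apply: map_f.
Qed.

Lemma words_fsets n (P : pred (n.-tuple I)) (F : {fset I}) :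
  ((\sum_(u <- words F n | P u) word_prob x u)%:E
     <= \esum_(u in [set u | P u]) (word_prob x u)%:E)%E.
Proof.
apply: esum_ge; exists [set` [seq u <- words F n | P u]].
  by split=> [|u /=]; [exact: finite_seq | rewrite mem_filter => /andP[]].
rewrite -fsbig_seq ?filter_uniq ?words_uniq ?fset_uniq // big_filter.
by rewrite sumEFin.
Qed.

(** The sum is a supremum over finite sets of words, among which those over finite alphabets are
    cofinal. It is finite because the words of length [n] over [F] have total weight at most 1. *)
Lemma esum_word_prob n (P : pred (n.-tuple I)) :
  let e := (\esum_(u in [set u | P u]) (word_prob x u)%:E)%E in
  e \is a fin_num /\
  (fun F : {fset I} => \sum_(u <- words F n | P u) word_prob x u) @ totally
    --> fine e.
Proof.
move=> e; have e_fin : e \is a fin_num.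
  rewrite ge0_fin_numE; last first.
    by apply: esum_ge0 => u _; rewrite lee_fin word_prob_ge0.
  apply: (@le_lt_trans _ _ 1%E); last exact: ltry.
  apply: ge_ereal_sup => _ [X /fsets_words[F /(_ F (fsubset_refl _)) leF] <-].
  by apply: (le_trans leF); rewrite lee_fin sum_word_prob_le1.
split=> //; apply: cvg_totally_le => [F|eps eps0].
  by rewrite -lee_fin fineK // words_fsets.
have [_ [X /fsets_words[F0 F0P] <-] ltX] := ub_ereal_sup_adherent eps0 e_fin.
exists F0 => F /F0P leF; rewrite -lte_fin EFinB fineK //.
exact: (lt_le_trans ltX).
Qed.

Lemma cvg_QS_prob n (W : {set 'S_n}) :
  (fun F : {fset I} => \sum_(u <- words F n | std u \in W) word_prob x u)
    @ totally --> QS_prob x W.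
Proof.
have QSP w : QS x w \is a fin_num /\
    (fun F : {fset I} => \sum_(u <- words F n | std u == w) word_prob x u) @ totally
    --> fine (QS x w).
  have -> : QS x w = (\esum_(u in [set u | std u == w]) (word_prob x u)%:E)%E.
    by congr esum; apply/seteqP; split => u /= /eqP.
  exact: esum_word_prob.
(* Exchanging [fine] with the sum requires every [QS x w] to be finite. *)
rewrite /QS_prob -sum_fine => [|w _]; last by have [] := QSP w.
have split_sum (F : {fset I}) :
    \sum_(u <- words F n | std u \in W) word_prob x u =
    \sum_(w in W) \sum_(u <- words F n | std u == w) word_prob x u.
  rewrite (partition_big (@std _ _ n) (mem W)) //=; apply: eq_bigr => w wW.
  by apply: eq_bigl => u; case: eqP => [->|_]; rewrite ?wW ?andbF.
rewrite (funext split_sum); apply: cvg_totally_sum => w _; exact: (QSP w).2.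
Qed.

End WordLimits.

(** * Coefficientwise limits in [R[[t]]] and [R[[t]][[z]]] *)

Section BivariateLimits.
Local Open Scope classical_set_scope.
Context {R : realType} {K : choiceType}.
Implicit Types (f g : {fset K} -> fps R) (h k : {fset K} -> fps (fps R)).

Definition fps_cvg f (l : fps R) : Prop := forall j,
  (fun F => fps_coef (f F) j) @ totally --> fps_coef l j.

Definition fps2_cvg h (l : fps (fps R)) : Prop := forall n,
  fps_cvg (fun F => fps_coef (h F) n) (fps_coef l n).

Lemma fps_cvg_cst (l : fps R) : fps_cvg (fun=> l) l.
Proof. by move=> j; apply: cvg_cst. Qed.

Lemma fps_cvgM f g l m :
  fps_cvg f l -> fps_cvg g m -> fps_cvg (fun F => f F * g F) (l * m).
Proof.
move=> fl gm j; apply: cvg_totally_sum => i _.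
by apply: cvgM; [apply: fl|apply: gm].
Qed.

Lemma fps2_cvgM h k l m :
  fps2_cvg h l -> fps2_cvg k m -> fps2_cvg (fun F => h F * k F) (l * m).
Proof.
move=> hl km n j; rewrite coef_fps_mul coef_fps_sum.
under eq_fun do rewrite coef_fps_mul coef_fps_sum.
by apply: cvg_totally_sum => i _; apply: fps_cvgM; [apply: hl|apply: km].
Qed.

Lemma fps2_cvg_dilate c h l :
  fps2_cvg h l -> fps2_cvg (fun F => dilate c (h F)) (dilate c l).
Proof. by move=> hl n; apply: fps_cvgM => //; apply: fps_cvg_cst. Qed.

Lemma fps_cvg_unique f l m : fps_cvg f l -> fps_cvg f m -> l = m.
Proof.
by move=> fl fm; apply: fpsP => j; apply: (cvg_unique _ (fl j) (fm j)).
Qed.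

Lemma fps2_cvg_unique h l m : fps2_cvg h l -> fps2_cvg h m -> l = m.
Proof.
by move=> hl hm; apply: fpsP => n; apply: (fps_cvg_unique (hl n) (hm n)).
Qed.

(** Immediate, since [cvg] means convergence to [lim] and [infprod] collects these limits. *)
Lemma multipliable_cvg (u : K -> fps (fps R)) : multipliable u ->
  fps2_cvg (fun F => \prod_(k <- F) u k) (infprod u).
Proof. by move=> mu n j; apply: mu. Qed.

Lemma cvg_multipliable (u : K -> fps (fps R)) l :
  fps2_cvg (fun F => \prod_(k <- F) u k) l -> multipliable u.
Proof. by move=> ul n j; apply: cvgP (ul n j). Qed.

Lemma cvg_infprod (u : K -> fps (fps R)) l :
  fps2_cvg (fun F => \prod_(k <- F) u k) l -> infprod u = l.
Proof.
move=> ul; apply: (fps2_cvg_unique _ ul); apply: multipliable_cvg.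
exact: cvg_multipliable ul.
Qed.

End BivariateLimits.

(** * Congruences modulo [t^N] and iteration of the functional equation *)

Section Congruence.
Context {R : realType}.
Implicit Types f g h : fps (fps R).

Definition eq_modt N f g : Prop :=
  forall n j, (j < N)%N -> coef2 f n j = coef2 g n j.

Lemma eq_modtM N f f' g g' :
  eq_modt N f f' -> eq_modt N g g' -> eq_modt N (f * g) (f' * g').
Proof.
move=> ff' gg' n j jN; rewrite /coef2 !coef_fps_mul !coef_fps_sum.
apply: eq_bigr => i _; rewrite !coef_fps_mul; apply: eq_bigr => k _.
congr *%R; [apply: ff'|apply: gg']; last by rewrite (leq_ltn_trans _ jN) ?leq_subr.
by rewrite (leq_ltn_trans _ jN) // -ltnS.
Qed.

Lemma coef2_dilate i f n j : coef2 (dilate (fpsX R ^+ i) f) n j =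
  if (j < i * n)%N then 0 else coef2 f n (j - i * n).
Proof. by rewrite /coef2 coef_dilate -exprM coef_fpsX_exp_mul. Qed.

(** The coefficient of [z^n] acquires the factor [t^(i n)], which is 0 modulo [t^N] for [n >= 1]. *)
Lemma eq_modt_dilate N i f : (N <= i)%N -> fps_coef f 0 = 1 ->
  eq_modt N (dilate (fpsX R ^+ i) f) 1.
Proof.
move=> Ni f0 [|n] j jN; rewrite coef2_dilate.
  by rewrite muln0 subn0 /coef2 f0.
by rewrite (leq_trans (leq_trans jN Ni)) ?leq_pmulr // /coef2 /=; case: (j).
Qed.

Lemma eq_modt_prod N (J : Type) (r : seq J) (P : pred J) F :
  (forall i, P i -> eq_modt N (F i) 1) -> eq_modt N (\prod_(i <- r | P i) F i) 1.
Proof.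
move=> F1; elim/big_rec: _ => [|i f Pi f1]; first by [].
by rewrite -[1]mulr1; apply: eq_modtM => //; apply: F1.
Qed.

Lemma cvg_prod_dilate A f : fps_coef A 0 = 1 -> fps_coef f 0 = 1 ->
  f = A * dilate (fpsX R) f ->
  fps2_cvg (fun F : {fset nat} => \prod_(i <- F) dilate (fpsX R ^+ i) A) f.
Proof.
move=> A0 f0 fA.
(* The equation iterated [N] times, with remainder [f(t^N z)]. *)
have f_iter N : \prod_(0 <= i < N) dilate (fpsX R ^+ i) A
                    * dilate (fpsX R ^+ N) f = f.
  elim: N => [|N IH]; first by rewrite big_geq ?leqnn ?mul1r ?expr0 ?dilate_id.
  have -> : dilate (fpsX R ^+ N.+1) f = dilate (fpsX R ^+ N) (dilate (fpsX R) f).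
    by rewrite dilate_dilate exprSr.
  by rewrite big_nat_recr ?leq0n // -mulrA -dilateM -fA IH.
move=> n j; apply: cvg_near_cst.
(* Modulo [t^(j+1)] the factors of index above [j] and the remainder [f(t^(j+1) z)] are all 1, so
   the coefficient is constant once [F] contains [0, ..., j]. *)
exists [fset i in index_iota 0 j.+1]%fset => //= F subF.
transitivity (coef2 (\prod_(0 <= i < j.+1) dilate (fpsX R ^+ i) A * 1) n j).
  rewrite (bigID (fun i => i < j.+1)%N) /=; apply: (@eq_modtM j.+1) => //.
    rewrite -big_filter (perm_big (index_iota 0 j.+1)) //.
    apply: uniq_perm; rewrite ?filter_uniq ?fset_uniq ?iota_uniq // => i.
    rewrite mem_filter [RHS](mem_index_iota 0 j.+1 i); case: ltnP => //= ij.
    by apply: (fsubsetP subF); rewrite in_fset /= (mem_index_iota 0 j.+1 i).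
  by apply: eq_modt_prod => i; rewrite -leqNgt => ji; apply: eq_modt_dilate.
rewrite -[in RHS](f_iter j.+1); apply: (@eq_modtM j.+1) => //.
by move=> n' j' lt; rewrite (@eq_modt_dilate j.+1).
Qed.

End Congruence.

(** * Geometric series and the product [A(z)] *)

Section Geometric.
Variable S : comNzRingType.
Implicit Types (c : S).

Definition geom c : fps S := Fps (fun n => c ^+ n).

Lemma geomK c : (1 - fpsC c * fpsX S) * geom c = 1.
Proof.
apply: fpsP => -[|n]; rewrite coef_fps_1BcXM; first by rewrite subr0 /= expr0.
by rewrite /= exprS subrr.
Qed.

Lemma dilate_geom c a : dilate c (geom a) = geom (c * a).
Proof. by apply: fpsP => n; rewrite /= exprMn. Qed.

End Geometric.

Section GeometricConstants.
Variable S : comNzRingType.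
Implicit Types (c : S).

Lemma fpsC_sum (J : Type) (r : seq J) (F : J -> S) :
  fpsC (\sum_(i <- r) F i) = \sum_(i <- r) fpsC (F i).
Proof.
apply: fpsP => n; rewrite coef_fps_sum; case: n => [|n] //=.
by rewrite big1.
Qed.

Lemma fpsC_exp c n : fpsC c ^+ n = fpsC (c ^+ n).
Proof. by elim: n => // n IH; rewrite exprS IH -fpsCM -exprS. Qed.

(** The coefficients in [z] are complete homogeneous symmetric polynomials in the [x a], hence
    constant in [t]; convergence becomes a question about real numbers. *)
Lemma coef_prod_geom (J : Type) (r : seq J) (x : J -> S) n :
  fps_coef (\prod_(a <- r) geom (fpsC (x a))) n =
  fpsC (fps_coef (\prod_(a <- r) geom (x a)) n).
Proof.
elim: r n => [|a r IH] n.
  by rewrite !big_nil; case: n => //= _; apply: fpsP => -[].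
rewrite !big_cons !coef_fps_mul fpsC_sum; apply: eq_bigr => i _.
by rewrite IH /= fpsC_exp fpsCM.
Qed.

End GeometricConstants.

(** Adding a letter gives a convolution that is dominated term by term by the binomial expansion,
    whose binomial coefficients are at least 1. *)
Lemma coef_prod_geom_bounds (R : realFieldType) (J : Type) (r : seq J)
    (x : J -> R) n :
  (forall a, 0 <= x a) ->
  0 <= fps_coef (\prod_(a <- r) geom (x a)) n <= (\sum_(a <- r) x a) ^+ n.
Proof.
move=> x0; elim: r n => [|a r IH] n.
  by rewrite !big_nil; case: n => [|n]; rewrite ?expr0 ?expr0n /= ?lexx ?ler01.
have s0 : 0 <= \sum_(a <- r) x a by apply: sumr_ge0.
rewrite !big_cons coef_fps_mul; apply/andP; split.
  apply: sumr_ge0 => i _; rewrite mulr_ge0 ?exprn_ge0 //.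
  by case/andP: (IH (n - i)%N).
rewrite addrC exprDn; apply: ler_sum => i _; have /andP[_ le] := IH (n - i)%N.
rewrite mulrC; apply: (@le_trans _ _ ((\sum_(a <- r) x a) ^+ (n - i) * x a ^+ i)).
  by rewrite ler_wpM2r // exprn_ge0.
by rewrite -[leLHS]mulr1n ler_wpMn2l ?bin_gt0 ?mulr_ge0 ?exprn_ge0 // -ltnS.
Qed.

Section GeometricLimit.
Local Open Scope classical_set_scope.
Context {R : realType} {K : choiceType}.
Variable x : K -> R.
Hypothesis x_ge0 : forall i, 0 <= x i.
Hypothesis x_le1 : forall F : {fset K}, \sum_(a <- F) x a <= 1.

Lemma multipliable_geom : multipliable (fun a => geom (fpsC (x a))).
Proof.
move=> n [|j]; rewrite /partial_prod_coef /coef2; last first.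
  by under eq_fun do rewrite coef_prod_geom; apply: is_cvg_cst.
under eq_fun do rewrite coef_prod_geom /=.
have ge0 (r : seq K) m := proj1 (andP (coef_prod_geom_bounds r m x_ge0)).
apply: (@nondecreasing_cvg_totally _ _ _ 1) => [F F' /fsubsetP FF'|F].
  (* Enlarging [F] multiplies the product by a series with constant term 1 and nonnegative
     coefficients, so no coefficient decreases. *)
  rewrite (perm_big _ (perm_sub_cat (fset_uniq F) (fset_uniq F') FF')) big_cat.
  rewrite coef_fps_mul big_ord_recr subnn coef0_fps_prod ?mulr1 //=.
  by rewrite lerDr sumr_ge0 // => i _; rewrite mulr_ge0 // ge0.
have /andP[_ le] := coef_prod_geom_bounds F n x_ge0.
by apply: (le_trans le); rewrite exprn_ile1 // sumr_ge0.
Qed.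

End GeometricLimit.

(** * Passage to the limit for a probability distribution on [I] *)

Section MajorIndexSeries.
Local Open Scope classical_set_scope.
Context {R : realType} {d : Order.disp_t} {I : orderType d}.
Variable x : I -> R.
Hypothesis x_distr : is_distr x.

Let x_ge0 : forall i, 0 <= x i. Proof. exact: x_distr.1. Qed.

Let x_le1 (F : {fset I}) : \sum_(a <- F) x a <= 1.
Proof.
rewrite -lee_fin -x_distr.2 -sumEFin; apply: esum_ge; exists [set` F].
  by split=> //; exact: finite_fset.
by rewrite -fsbig_seq ?fset_uniq.
Qed.

Let t := fpsX R.
Let xt (a : I) : fps R := fpsC (x a).

Lemma unit_1BtX n : 1 - t ^+ n.+1 \is a GRing.unit.
Proof.
rewrite fps_unitE coef_fpsB -[t ^+ _]mulr1 coef_fpsX_exp_mul /=.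
by rewrite subr0 unitr1.
Qed.

Lemma coef_word_gf w s n j : fps_coef (word_gf t w s xt n) j =
  \sum_(u <- words s n | desc_sum w u == j) word_prob x u.
Proof.
rewrite /word_gf coef_fps_sum [RHS]big_mkcond; apply: eq_bigr => u _.
have -> : \prod_(a <- u) xt a = fpsC (word_prob x u).
  by rewrite word_probE (big_morph _ (@fpsCM R) (@fpsC1 R)).
rewrite coef_fpsX_exp_mul; case: ltngtP => //= [|->]; last by rewrite subnn.
by rewrite -subn_gt0; case: (j - _)%N.
Qed.

Lemma cvg_inv_gf n : fps_cvg (fun F : {fset I} => word_gf t inv_wt F xt n)
  (Fps (fun j => inv_prob x n j)).
Proof.
move=> j; under eq_fun do rewrite coef_word_gf.
have := @cvg_QS_prob _ _ _ x x_ge0 x_le1 n [set w : 'S_n | inv_perm w == j]%SET.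
by under eq_fun do under eq_bigl do rewrite inE inv_perm_std.
Qed.

Lemma cvg_maj_gf n : fps_cvg (fun F : {fset I} => word_gf t maj_wt F xt n)
  (Fps (fun j => maj_prob x n j)).
Proof.
move=> j; under eq_fun do rewrite coef_word_gf.
have := @cvg_QS_prob _ _ _ x x_ge0 x_le1 n [set w : 'S_n | maj_perm w == j]%SET.
by under eq_fun do under eq_bigl do rewrite inE maj_perm_std.
Qed.

(** The two generating functions agree on every finite alphabet, and limits are unique. *)
Lemma maj_inv_prob n j : maj_prob x n j = inv_prob x n j.
Proof.
have gfE : (fun F : {fset I} => word_gf t maj_wt F xt n)
         = (fun F : {fset I} => word_gf t inv_wt F xt n).
  apply: funext => F.
  by rewrite (inv_gfE unit_1BtX) ?(maj_gfE unit_1BtX) ?fset_uniq.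
have := @cvg_maj_gf n; rewrite gfE => cvg_maj.
exact: (congr1 (@fps_coef R ^~ j) (fps_cvg_unique cvg_maj (@cvg_inv_gf n))).
Qed.

Lemma cvg_qprod_maj_gf :
  fps2_cvg (fun F : {fset I} => qprod t F xt) (maj_gf x).
Proof.
move=> n; have := fps_cvgM (@cvg_maj_gf n) (@fps_cvg_cst _ _ (qfact t n)^-1).
congr fps_cvg; apply: funext => F.
rewrite (maj_gfE unit_1BtX) ?fset_uniq // mulrAC mulrV ?mul1r //.
exact: (qfact_unit unit_1BtX).
Qed.

(** Both sides are inverse to the unit [1 - t^i x_a z]. *)
Lemma qs_factorE i a : qs_factor x i a = dilate (t ^+ i) (geom (xt a)).
Proof.
rewrite dilate_geom /qs_factor; set y := t ^+ i * xt a.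
have -> : tvar R ^+ i * fps2C (x a) * zvar R = fpsC y * fpsX (fps R).
  by rewrite /tvar fpsC_exp -fpsCM.
have uy : 1 - fpsC y * fpsX (fps R) \is a GRing.unit.
  by apply/unitrPr; exists (geom y); apply: geomK.
by apply: (mulrI uy); rewrite geomK divrr.
Qed.

Lemma cvg_prod_qs_factor i :
  fps2_cvg (fun F : {fset I} => \prod_(a <- F) qs_factor x i a)
    (dilate (t ^+ i) (infprod (fun a => geom (xt a)))).
Proof.
have := fps2_cvg_dilate (c := t ^+ i)
  (multipliable_cvg (multipliable_geom x_ge0 x_le1)).
congr fps2_cvg; apply: funext => F; rewrite dilate_prod.
by apply: eq_bigr => a _; rewrite qs_factorE.
Qed.

Lemma coef0_infprod_geom : fps_coef (infprod (fun a => geom (xt a))) 0 = 1.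
Proof.
have := @multipliable_cvg _ _ _ (multipliable_geom x_ge0 x_le1) 0%N.
move/fps_cvg_unique; apply; have := @fps_cvg_cst R I 1.
congr fps_cvg; apply: funext => F.
by rewrite coef0_fps_prod.
Qed.

Lemma coef0_maj_gf : fps_coef (maj_gf x) 0 = 1.
Proof.
have := @cvg_qprod_maj_gf 0%N; move/fps_cvg_unique; apply.
have := @fps_cvg_cst R I 1; congr fps_cvg; apply: funext => F.
by rewrite coef0_qprod.
Qed.

(** The limit of [P(z) = A(z) P(t z)] over finite alphabets, where each [geom (xt a)] cancels the
    factor [1 - x_a z] of [dilate_qprod]. *)
Lemma maj_gf_dilate :
  maj_gf x = infprod (fun a => geom (xt a)) * dilate t (maj_gf x).
Proof.
apply: (fps2_cvg_unique cvg_qprod_maj_gf).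
have := fps2_cvgM (multipliable_cvg (multipliable_geom x_ge0 x_le1))
  (fps2_cvg_dilate (c := t) cvg_qprod_maj_gf).
congr fps2_cvg; apply: funext => F.
rewrite (dilate_qprod unit_1BtX) mulrA -big_split big1 ?mul1r // => a _.
by rewrite /= mulrC geomK.
Qed.

End MajorIndexSeries.

Theorem theorem3p2 (R : realType) (d : Order.disp_t) (I : orderType d)
    (x : I -> R) (x_distr : is_distr x) :
  (forall n j : nat, maj_prob x n j = inv_prob x n j) /\
  [/\ forall i : nat, multipliable (fun j : I => qs_factor x i j),
      multipliable (fun i : nat => infprod (fun j : I => qs_factor x i j))
    & maj_gf x = infprod (fun i : nat => infprod (fun j : I => qs_factor x i j))].
Proof.
split; first exact: maj_inv_prob.
(* The inner product of index [i] is [A(t^i z)], which puts the outer product in the form treated by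
   [cvg_prod_dilate]. *)
have infprodE i := cvg_infprod (@cvg_prod_qs_factor _ _ _ x x_distr i).
have cvg_maj : fps2_cvg (fun F : {fset nat} =>
    \prod_(i <- F) infprod (fun j : I => qs_factor x i j)) (maj_gf x).
  have := cvg_prod_dilate (coef0_infprod_geom x_distr)
    (coef0_maj_gf x_distr) (maj_gf_dilate x_distr).
  by congr fps2_cvg; apply: funext => F; apply: eq_bigr => i _; rewrite infprodE.
split=> [i||].
- exact: cvg_multipliable (@cvg_prod_qs_factor _ _ _ x x_distr i).
- exact: cvg_multipliable cvg_maj.
- exact/esym/cvg_infprod.
Qed.
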